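(* Let $f$ be a multiplicative graph invariant with $f(F)\neq 0$ for every graph $F$ and with $f(K_1)\neq 1$. Let $G$ be a non-complete graph. Then $vs_f(G)\leq \delta(G)+1$, where $\delta(G)$ is the minimum degree of $G$.
   Context: All graphs are finite and simple (the graph with no vertices is allowed as a value of $G-X$; it is not regarded as a non-complete graph). An invariant is a function $f$ from graphs to $[0,\infty)$ that is constant on isomorphism classes. $H_1\sqcup H_2$ denotes disjoint union. $f$ is multiplicative if $f(H_1\sqcup H_2)=f(H_1)\cdot f(H_2)$ for all disjoint graphs $H_1,H_2$. The $f$-vertex stability number is $vs_f(G)=\min\{|X|: X\subseteq V(G),\ f(G-X)\neq f(G)\}$, and $vs_f(G)=\infty$ if $f(G-X)=f(G)$ for all $X\subseteq V(G)$ ($X=V(G)$ is allowed). *)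

(* Defs.v *)
From HB Require Import structures.
From mathcomp Require Import all_boot all_order all_algebra.
From mathcomp Require Import reals constructive_ereal.
Set Implicit Arguments.
Unset Strict Implicit.
Unset Printing Implicit Defensive.
Import Order.TTheory GRing.Theory Num.Theory.
Local Open Scope ring_scope.

Record sgraph := SGraph {
  vertex :> finType;
  adj : rel vertex;
  adj_sym : symmetric adj;
  adj_irrefl : irreflexive adj }.

Definition sgraph_iso (G H : sgraph) : Prop :=
  exists2 h : G -> H, bijective h & forall x y, adj (h x) (h y) = adj x y.

Definition is_complete (G : sgraph) : bool :=
  [forall x : G, forall y : G, (x != y) ==> adj x y].

Section CompleteGraph.
Variable n : nat.
Definition Kn_adj : rel 'I_n := fun i j => i != j.
Lemma Kn_adj_sym : symmetric Kn_adj.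
Proof. by move=> i j; rewrite /Kn_adj eq_sym. Qed.
Lemma Kn_adj_irrefl : irreflexive Kn_adj.
Proof. by move=> i; rewrite /Kn_adj eqxx. Qed.
Definition Kn : sgraph := SGraph Kn_adj_sym Kn_adj_irrefl.
End CompleteGraph.

Section DisjointUnion.
Variables G H : sgraph.
Definition dunion_adj : rel (G + H)%type := fun u v =>
  match u, v with
  | inl x, inl y => adj x y
  | inr x, inr y => adj x y
  | _, _ => false
  end.
Lemma dunion_adj_sym : symmetric dunion_adj.
Proof. by move=> [x|x] [y|y] //=; rewrite adj_sym. Qed.
Lemma dunion_adj_irrefl : irreflexive dunion_adj.
Proof. by move=> [x|x] /=; rewrite adj_irrefl. Qed.
Definition dunion : sgraph := SGraph dunion_adj_sym dunion_adj_irrefl.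
End DisjointUnion.

Section Deletion.
Variables (G : sgraph) (X : {set G}).
Definition del_adj : rel {x : G | x \notin X} :=
  fun u v => adj (val u) (val v).
Lemma del_adj_sym : symmetric del_adj.
Proof. by move=> u v; rewrite /del_adj adj_sym. Qed.
Lemma del_adj_irrefl : irreflexive del_adj.
Proof. by move=> u; rewrite /del_adj adj_irrefl. Qed.
Definition del : sgraph := SGraph del_adj_sym del_adj_irrefl.
End Deletion.

Definition deg (G : sgraph) (v : G) : nat := #|[set w | adj v w]|.

(* Every degree is less than #|G|, so the default value #|G| never affects the
   minimum when G has a vertex; the value is 0 on the graph with no vertices. *)
Definition mindeg (G : sgraph) : nat := \big[minn/#|G|]_(v : G) deg v.

Section Invariants.
Variable R : realType.
Implicit Type f : sgraph -> R.

Definition graph_invariant f : Prop :=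
  (forall G, 0 <= f G) /\ (forall G H, sgraph_iso G H -> f G = f H).

(* For isomorphism-invariant f, testing on tagged unions is the same as testing
   on graphs with disjoint vertex sets. *)
Definition graph_multiplicative f : Prop :=
  forall G H, f (dunion G H) = f G * f H.

(* Valued in \bar R so that the minimum over an empty family is +oo. *)
Definition vs f (G : sgraph) : \bar R :=
  \big[Order.min/+oo%E]_(X : {set G} | f (del X) != f G) (#|X|%:R)%:E.
End Invariants.

(* Main.v *)
(** Let [v] be a vertex of minimum degree. In [G - N(v)] the vertex [v] is
    isolated, so [f (G - N(v)) = f K_1 * f (G - N[v])]. As [f K_1 != 1] and [f]
    never vanishes, deleting [N(v)] or deleting [N[v]] changes [f]. *)
Require Import Defs.
From HB Require Import structures.
From mathcomp Require Import all_boot all_order all_algebra.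
From mathcomp Require Import reals constructive_ereal.
Set Implicit Arguments.
Unset Strict Implicit.
Unset Printing Implicit Defensive.
Import Order.TTheory GRing.Theory Num.Theory.
Local Open Scope ring_scope.

(** The vertex [x0] makes [G] nonempty, so some vertex minimizes [deg]. *)
Lemma ex_deg_le_mindeg (G : sgraph) (x0 : G) :
  exists v : G, (deg v <= mindeg G)%N.
Proof.
case: (arg_minnP (P := predT) (@deg G) (isT : predT x0)) => v _ v_min.
exists v; rewrite /mindeg; elim/big_ind: _ => [|m n vm vn|w _].
(* The default value [#|G|] of the minimum must also be at least [deg v]. *)
- exact: max_card.
- by rewrite leq_min vm.
- exact: v_min.
Qed.

(** Once all its neighbours are deleted, [v] is isolated and splits off as a copy of [K_1]. *)
Lemma sgraph_iso_isolated (G : sgraph) (X : {set G}) (v : G) :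
  v \notin X -> (forall w, adj v w -> w \in X) ->
  sgraph_iso (dunion (Kn 1) (del (v |: X))) (del X).
Proof.
move=> vX NvX.
have notinX (w : {x : G | x \notin v |: X}) : val w \notin X.
  by have := valP w; rewrite in_setU1 negb_or => /andP[].
pose h (u : dunion (Kn 1) (del (v |: X))) : del X :=
  match u with inl _ => Sub v vX | inr w => Sub (val w) (notinX w) end.
(* Since [x] lies outside [X], [insub] fails exactly when [val x = v]. *)
pose g (x : del X) : dunion (Kn 1) (del (v |: X)) :=
  if insub (val x) is Some w then inr w else inl ord0.
have v_nadj (w : {x : G | x \notin v |: X}) : adj v (val w) = false.
  by apply: contraNF (notinX w); exact: NvX.
exists h.
  exists g => [[i|w]|x]; rewrite /g /h.
  - by rewrite insubF ?(ord1 i)//= setU11.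
  - by rewrite SubK valK.
  - case: insubP => [w _ wx|vx]; apply: val_inj; rewrite /= ?SubK //.
    by apply/esym/eqP; move: vx; rewrite in_setU1 negbK (negPf (valP x)) orbF.
move=> [i|w] [j|w'] //=; rewrite /del_adj ?SubK //=.
- by rewrite adj_irrefl /Kn_adj !ord1 eqxx.
- exact: v_nadj.
- by rewrite adj_sym v_nadj.
Qed.

Lemma vs_le_card (R : realType) (f : sgraph -> R) (G : sgraph) (X : {set G}) :
  f (del X) != f G -> (vs f G <= (#|X|%:R)%:E)%E.
Proof. by move=> fX; apply: bigmin_le_cond. Qed.

Theorem theorem2p2 (R : realType) (f : sgraph -> R) (G : sgraph)
  (f_inv : graph_invariant f) (f_mult : graph_multiplicative f)
  (f_neq0 : forall F : sgraph, f F != 0) (f_K1 : f (Kn 1%N) != 1)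
  (G_noncomplete : ~~ is_complete G) :
  (vs f G <= ((mindeg G).+1%:R)%:E)%E.
Proof.
(* Non-completeness supplies a vertex. *)
have [x0 _] := forallPn G_noncomplete.
have [v deg_v] := ex_deg_le_mindeg x0.
pose N := [set w | adj v w].
have vN : v \notin N by rewrite inE adj_irrefl.
have vs_le (X : {set G}) : (#|X| <= (deg v).+1)%N -> f (del X) != f G ->
    (vs f G <= ((mindeg G).+1%:R)%:E)%E.
  move=> cardX /vs_le_card/le_trans; apply.
  by rewrite lee_fin ler_nat (leq_trans cardX).
(* If deleting [N] changes [f], then [deg v] vertices suffice; otherwise [v] is deleted as well. *)
have [fN|] := eqVneq (f (del N)) (f G); last exact: vs_le.
apply: (vs_le (v |: N)); first by rewrite cardsU1 vN.
have NvN w : adj v w -> w \in N by rewrite inE.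
(* If neither deletion changed [f], then [f K_1 * f G = f G], and cancelling [f G] would give
   [f K_1 = 1]. *)
apply: contra_neq f_K1 => fvN; apply: (mulIf (f_neq0 G)).
by rewrite mul1r -{1}fvN -f_mult (f_inv.2 _ _ (sgraph_iso_isolated vN NvN)).
Qed.
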